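(* (i) Let $G$ be a regular bi-directed graph with $P$ vertices and $Q$ bi-directed edges (i.e. $Q$ adjacent pairs, each present in both directions). Then every communication graph for universal broadcast on $G$ has time $\tau\ge \frac{P(P-1)}{2Q}$. (ii) Let $G$ be a regular directed graph with $P$ vertices in which every vertex has in-degree and out-degree $d$. Then every communication graph for universal broadcast on $G$ has time $\tau\ge\frac{P-1}{d}$.
   Context: A task graph is a finite sequence $(e_i)$ of directed edges of $G$ labeled by positive integer times $t(e_i)$ such that (i) $t(e_i)<t(e_j)$ implies $e_i<e_j$ or $e_i,e_j$ incomparable, and (ii) $t(e_i)=t(e_j)$ implies $i=j$ or $e_i,e_j$ incomparable, where $e_i<e_j$ means there is a directed path in the task graph beginning with $e_i$ and ending with $e_j$; its time is its maximum label. A communication graph is a collection of task graphs such that no directed edge carries a given label more than once in the collection (so the two directions of a bi-directed edge may be used at the same time); its time is the maximum time of its task graphs. A communication graph for universal broadcast consists, for each vertex $v$, of a task graph containing a directed path from $v$ to every other vertex. *)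

(* Defs.v *)
From HB Require Import structures.
From mathcomp Require Import all_boot all_order all_algebra.

Set Implicit Arguments.
Unset Strict Implicit.
Unset Printing Implicit Defensive.

(* A directed graph on V is a relation E : rel V; E x y means that the        *)
(* directed edge (x, y) is present.                                           *)

Definition regular_digraph (V : finType) (E : rel V) (d : nat) : Prop :=
  forall v : V, #|[set w | E v w]| = d /\ #|[set w | E w v]| = d.

Definition bidirected (V : finType) (E : rel V) : Prop :=
  symmetric E /\ irreflexive E.

Definition num_biedges (V : finType) (E : rel V) : nat :=
  #|[set [set p.1; p.2] | p : V * V & E p.1 p.2]|.

(* The items of the sequence are the positions i : 'I_(size s), so an edge    *)
(* may occur several times, with different labels. The pair ((x, y), t) is    *)
(* the directed edge (x, y) labeled t.                                        *)
Definition labeled_edges (V : finType) := seq ((V * V) * nat).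

Definition edge_at (V : finType) (s : labeled_edges V) (i : 'I_(size s)) :
  V * V := (tnth (in_tuple s) i).1.

Definition label_at (V : finType) (s : labeled_edges V) (i : 'I_(size s)) :
  nat := (tnth (in_tuple s) i).2.

(* e_i < e_j: some directed path e_i = e_(k_0), ..., e_(k_m) = e_j in the     *)
(* task graph, the head of each edge being the tail of the next one. The      *)
(* one-edge path gives e_i < e_i, hence the clause i = j in is_task_graph.    *)
Definition precedes (V : finType) (s : labeled_edges V) : rel 'I_(size s) :=
  connect (fun i j => (edge_at i).2 == (edge_at j).1).

Definition incomparable (V : finType) (s : labeled_edges V)
  (i j : 'I_(size s)) : Prop := ~ precedes i j /\ ~ precedes j i.

Definition is_task_graph (V : finType) (E : rel V) (s : labeled_edges V) :
  Prop :=
  [/\ forall i : 'I_(size s), E (edge_at i).1 (edge_at i).2,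
      forall i : 'I_(size s), 0 < label_at i,
      forall i j : 'I_(size s), label_at i < label_at j ->
        precedes i j \/ incomparable i j
    & forall i j : 'I_(size s), label_at i = label_at j ->
        i = j \/ incomparable i j].

Definition task_time (V : finType) (s : labeled_edges V) : nat :=
  \max_(x <- s) x.2.

(* The uniqueness condition counts occurrences both within one task graph     *)
(* and across the members of the collection.                                  *)
Definition is_communication_graph (V : finType) (E : rel V) (I : finType)
  (C : I -> labeled_edges V) : Prop :=
  (forall k : I, is_task_graph E (C k)) /\
  uniq (flatten [seq C k | k <- enum I]).

Definition communication_time (V I : finType) (C : I -> labeled_edges V) :
  nat := \max_(k : I) task_time (C k).

Definition has_path (V : finType) (s : labeled_edges V) (v w : V) : Prop :=
  connect (fun x y => (x, y) \in [seq e.1 | e <- s]) v w.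

Definition universal_broadcast (V : finType) (E : rel V)
  (C : V -> labeled_edges V) : Prop :=
  is_communication_graph E C /\
  (forall v w : V, w != v -> has_path (C v) v w).

(* Main.v *)
(* Every vertex other than v is the head of an edge of the task graph rooted  *)
(* at v, so that task graph has at least P - 1 labeled edges. The P(P - 1)    *)
(* labeled edges of the collection are pairwise distinct and lie in the       *)
(* product of the set of directed edges with {1, ..., tau}; hence             *)
(* P(P - 1) <= tau * #directed edges, where #directed edges is P * d, resp.   *)
(* at most 2 * Q.                                                             *)

Require Import Defs.
From HB Require Import structures.
From mathcomp Require Import all_boot all_order all_algebra.

Set Implicit Arguments.
Unset Strict Implicit.
Unset Printing Implicit Defensive.

Import Order.TTheory GRing.Theory Num.Theory.
Local Open Scope ring_scope.

(** The argument is a capacity count: [size_task_graph_ge] bounds the demand from below,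
    [size_communication_graph_le] bounds the supply of (edge, label) slots from above, and
    [universal_broadcast_bound] compares them. The two parts differ only in how the directed edges
    are counted: [card_digraph_edges_le] or [card_digraph_edges]. *)

Definition digraph_edges (V : finType) (E : rel V) : {set V * V} :=
  [set p | E p.1 p.2].

Lemma card_digraph_edges (V : finType) (E : rel V) (d : nat) :
  regular_digraph E d -> #|digraph_edges E| = (#|V| * d)%N.
Proof.
move=> regE; rewrite -sum1_card.
rewrite (eq_bigl (fun p : V * V => true && E p.1 p.2)); last first.
  by move=> p; rewrite inE.
rewrite -(pair_big_dep xpredT E (fun _ _ => 1%N)) /=.
rewrite -sum_nat_const; apply: eq_bigr => v _.
by rewrite sum1_card -(regE v).1; apply: eq_card => w; rewrite inE.
Qed.

(** Forgetting orientation maps directed edges onto unordered pairs, with fibres contained in {(x,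
    y), (y, x)}. *)
Lemma card_digraph_edges_le (V : finType) (E : rel V) :
  (#|digraph_edges E| <= 2 * num_biedges E)%N.
Proof.
pose ends (p : V * V) := [set p.1; p.2].
rewrite -sum1_card (partition_big_imset ends) /= mulnC.
have -> : num_biedges E = #|ends @: digraph_edges E|.
  apply: eq_card => B.
  by apply/imsetP/imsetP => -[p Ep ->]; exists p => //; rewrite inE in Ep *.
rewrite -sum_nat_const; apply: leq_sum => B /imsetP[[x y] _ ->].
rewrite sum1_card; apply: leq_trans (subset_leq_card _) (card_size [:: (x, y); (y, x)]).
apply/subsetP => -[a b]; rewrite unfold_in /= => /andP[_ /eqP/setP eq_ab].
(* Testing {a, b} = {x, y} at the four points leaves a finite Boolean check. *)
have := (eq_ab x, eq_ab y, eq_ab a, eq_ab b); rewrite !inE !xpair_eqE !eqxx /=.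
rewrite !orbT ![x == _]eq_sym ![y == _]eq_sym.
by case: (a == x); case: (a == y); case: (b == x); case: (b == y) => // -[[[]]].
Qed.

(** Since [w] differs from [v], the path is nonempty, and its last edge enters [w]. *)
Lemma has_path_head (V : finType) (s : labeled_edges V) (v w : V) :
  w != v -> has_path s v w -> w \in [seq e.1.2 | e <- s].
Proof.
move=> neq_wv /connectP[p]; case/lastP: p => [_ eq_wv|p x].
  by rewrite eq_wv eqxx in neq_wv.
rewrite rcons_path last_rcons => /andP[_ /mapP[e e_s eq_e]] ->.
by apply/mapP; exists e => //; rewrite -eq_e.
Qed.

Lemma size_task_graph_ge (V : finType) (s : labeled_edges V) (v : V) :
  (forall w, w != v -> has_path s v w) -> (#|V|.-1 <= size s)%N.
Proof.
move=> reach; rewrite -(cardC1 v) cardE -(size_map (fun e => e.1.2) s).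
apply: uniq_leq_size (enum_uniq _) _ => w; rewrite mem_enum inE => neq_wv.
exact: has_path_head neq_wv (reach w neq_wv).
Qed.

Lemma size_communication_graph_le (V I : finType) (E : rel V)
    (C : I -> labeled_edges V) :
  is_communication_graph E C ->
  (\sum_(k : I) size (C k) <= #|digraph_edges E| * communication_time C)%N.
Proof.
case=> taskC uniqC.
have -> : (\sum_k size (C k) = size (flatten [seq C k | k <- enum I]))%N.
  by rewrite size_flatten sumnE /shape -map_comp big_map big_enum.
(* The slots are listed as edges times [iota 1 tau], which starts at 1 because labels are
   positive. *)
rewrite cardE -[communication_time C](size_iota 1) -(size_allpairs pair).
apply: uniq_leq_size uniqC _ => -[e t] /flatten_mapP[k _ et_Ck].
have [edgeC label_gt0 _ _] := taskC k.
have [i eq_i] := seq_tnthP et_Ck.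
have Ee := edgeC i; have t_gt0 := label_gt0 i.
rewrite /edge_at /label_at -eq_i /= in Ee t_gt0.
apply: allpairs_f; first by rewrite mem_enum inE.
rewrite mem_iota t_gt0 add1n ltnS /=.
apply: leq_trans (leq_bigmax k).
exact: (@leq_bigmax_seq _ _ xpredT (fun x => x.2) _ et_Ck isT).
Qed.

Lemma universal_broadcast_bound (V : finType) (E : rel V)
    (C : V -> labeled_edges V) :
  universal_broadcast E C ->
  (#|V| * #|V|.-1 <= #|digraph_edges E| * communication_time C)%N.
Proof.
case=> commC reach; apply: leq_trans (size_communication_graph_le commC).
rewrite -sum_nat_const; apply: leq_sum => v _.
exact: size_task_graph_ge (reach v).
Qed.

Lemma ler_div_nat (a b c : nat) :
  (a <= b * c)%N -> a%:R / b%:R <= c%:R :> rat.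
Proof.
(* For [b = 0] the quotient is 0 by convention. *)
case: b => [|b] le_abc; first by rewrite invr0 mulr0 ler0n.
by rewrite ler_pdivrMr ?ltr0Sn // -natrM ler_nat mulnC.
Qed.

Theorem theorem3p5 :
  (forall (V : finType) (E : rel V) (P Q : nat),
     bidirected E -> (exists d : nat, regular_digraph E d) ->
     #|V| = P -> num_biedges E = Q ->
     forall C : V -> labeled_edges V, universal_broadcast E C ->
       (P%:R * (P%:R - 1)) / (2 * Q%:R) <= (communication_time C)%:R :> rat)
  /\
  (forall (V : finType) (E : rel V) (P d : nat),
     regular_digraph E d -> #|V| = P ->
     forall C : V -> labeled_edges V, universal_broadcast E C ->
       (P%:R - 1) / d%:R <= (communication_time C)%:R :> rat).
Proof.
split=> [V E P Q _ _ <- <- C castC | V E P d regE <- C castC];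
  have := universal_broadcast_bound castC.
- move=> bound; have {}bound := leq_trans bound
    (leq_mul (card_digraph_edges_le E) (leqnn _)).
  have -> : #|V|%:R * (#|V|%:R - 1) = (#|V| * #|V|.-1)%:R :> rat.
    (* At 0 the truncated predecessor is harmless: both products vanish. *)
    by case: #|V| => [|n]; rewrite ?mul0r // natrM -natr1 addrK.
  by rewrite -natrM ler_div_nat.
- rewrite (card_digraph_edges regE) -mulnA.
  (* An empty [V] admits no cancellation of [#|V|], but then the left side is -1/d, at most 0. *)
  have [->|V_gt0] := posnP #|V|.
    by rewrite sub0r mulN1r (@le_trans _ _ 0) ?oppr_le0 ?invr_ge0 ?ler0n.
  rewrite leq_pmul2l // => /ler_div_nat.
  by rewrite -subn1 natrB.
Qed.
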